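(* Let $Y_1,\ldots,Y_n$ be independent random variables, each taking values in $\mathbb{R}^m$, such that $\Pr[Y_i[j]\in[\ell_i[j],u_i[j]]]=1$ for all $i=1,\ldots,n$ and $j=1,\ldots,m$, where $\ell_i,u_i\in\mathbb{R}^m$. Let $Y=\sum_{i=1}^n Y_i$ and $\mu=\mathbb{E}[Y]$. Then for every $\delta>0$, \[ \Pr\Big[\lVert Y-\mu\rVert_1 \ge 1.12\cdot\sum_{j=1}^m\sqrt{\textstyle\sum_{i=1}^n(\ell_i[j]-u_i[j])^2} + \delta\Big] \le 2\exp\Big(-(2\delta^2)\Big/\textstyle\sum_{i=1}^n\big[\sum_{j=1}^m(u_i[j]-\ell_i[j])\big]^2\Big). \]
   Context: For a vector $x$, $x[j]$ denotes its $j$-th entry. *)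

(* Defs.v *)
From HB Require Import structures.
From mathcomp Require Import all_boot all_order all_algebra.
From mathcomp Require Import all_classical all_reals all_analysis.

Set Implicit Arguments.
Unset Strict Implicit.
Unset Printing Implicit Defensive.

Import Order.TTheory GRing.Theory Num.Theory.

Local Open Scope classical_set_scope.
Local Open Scope ring_scope.

(* Vectors of R^m are [m.-tuple R]: this type carries the product (= Borel)
   sigma-algebra, so [{RV P >-> m.-tuple R}] is the type of R^m-valued random
   variables. *)

Definition vec_sum (R : realType) (n m : nat) (v : 'I_n -> m.-tuple R) :
    m.-tuple R :=
  [tuple \sum_(i < n) tnth (v i) j | j < m].

Definition vec_sub (R : realType) (m : nat) (x y : m.-tuple R) : m.-tuple R :=
  [tuple tnth x j - tnth y j | j < m].

Definition norm1 (R : realType) (m : nat) (x : m.-tuple R) : R :=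
  \sum_(j < m) `|tnth x j|.

(* [fine] sends infinite coordinates to 0, so this is the expectation only when
   every coordinate of X is integrable. *)
Definition vec_expectation (d : measure_display) (T : measurableType d)
    (R : realType) (P : probability T R) (m : nat) (X : T -> m.-tuple R) :
    m.-tuple R :=
  [tuple fine 'E_P[(fun w => tnth (X w) j)] | j < m].

Definition mutually_independent (d d' : measure_display) (T : measurableType d)
    (T' : measurableType d') (R : realType) (P : probability T R)
    (I : finType) (X : I -> {RV P >-> T'}) : Prop :=
  forall (J : {set I}) (A : I -> set T'),
    (forall i, i \in J -> measurable (A i)) ->
    P (\bigcap_(i in [set` J]) (X i @^-1` A i)) =
      (\prod_(i in J) P (X i @^-1` A i))%E.

(* Main.v *)
Require Import Defs.
From HB Require Import structures.
From mathcomp Require Import all_boot all_order all_algebra.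
From mathcomp Require Import all_classical all_reals all_analysis.
From mathcomp Require Import measurable_realfun ring lra.

Set Implicit Arguments.
Unset Strict Implicit.
Unset Printing Implicit Defensive.

Import Order.TTheory GRing.Theory Num.Theory.
Import numFieldNormedType.Exports.

Local Open Scope classical_set_scope.
Local Open Scope ring_scope.

(** The function [y |-> |y - mu|_1] changes by at most [c_i = sum_j (u_i[j] - l_i[j])]
    when only [Y_i] varies, so McDiarmid's inequality bounds its upper deviations
    from its mean by [exp (- 2 delta^2 / sum_i c_i^2)]. For that mean, each
    coordinate of [Y - mu] has moment generating function at most [exp (t^2 v / 8)]
    with [v = sum_i (u_i[j] - l_i[j])^2], which forces
    [E |Y[j] - mu[j]| <= (3/4) sqrt v], well below the allowed [1.12 sqrt v].

    McDiarmid's inequality is only needed for functions [g] of a sum: conditioning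
    on all the summands but [Y_i] amounts to replacing [g] by
    [x |-> E g (x + Y_i)], which inherits the bounded differences of [g], and the
    inner integral is controlled by Hoeffding's lemma. *)

(** * Joint laws and the independence of a partial sum from the remaining variables *)

(** Rectangles generate the product sigma-algebra and are stable under intersection, so this is
    uniqueness of measures on a pi-system; the finite mass of [m1] lets the constant sequence [setT]
    serve as the exhausting cover. *)
Lemma finite_measure_eq_setX (d1 d2 : measure_display)
    (T1 : measurableType d1) (T2 : measurableType d2) (R : realType)
    (m1 m2 : {measure set (T1 * T2) -> \bar R}) :
  (m1 setT < +oo)%E ->
  (forall A B, measurable A -> measurable B -> m1 (A `*` B) = m2 (A `*` B)) ->
  forall D, measurable D -> m1 D = m2 D.
Proof.
move=> m1T m12 D mD.
apply: (measure_unique [set A `*` B | A in measurable & B in measurable]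
  (fun _ => setT)) => //.
- exact: measurable_prod_measurableType.
- move=> _ _ [A mA [B mB <-]] [A' mA' [B' mB' <-]].
  exists (A `&` A'); first exact: measurableI.
  by exists (B `&` B'); [exact: measurableI|rewrite setXI].
- by move=> _; exists setT => //; exists setT => //; rewrite setXTT.
- by rewrite bigcup_const.
- by move=> _ [A mA [B mB <-]]; exact: m12.
Qed.

Section partial_products.
Context (d d' : measure_display) (T : measurableType d) (V : measurableType d')
  (R : realType) (P : probability T R) (I : finType) (Z : I -> {RV P >-> V})
  (idx : V) (op : Monoid.com_law idx).
Hypothesis measurable_op : measurable_fun setT (fun p : V * V => op p.1 p.2).

Lemma measurable_big_op (s : seq I) :
  measurable_fun setT (fun w => \big[op/idx]_(i <- s) Z i w).
Proof.
elim: s => [|i s IHs]; first by under eq_fun do rewrite big_nil; exact: measurable_cst.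
under eq_fun do rewrite big_cons.
exact: (measurableT_comp measurable_op (measurable_fun_pair _ IHs)).
Qed.

(* Restricted to [E], the joint law of the product over [s] and of the next variable
   is [P E] times the unrestricted one, since the two measures agree on rectangles. *)
Lemma mutually_independent_big_op (s : seq I) (J : {set I}) (A : set V)
    (B : I -> set V) :
  mutually_independent Z -> uniq s -> {in s, forall i, i \notin J} ->
  measurable A -> (forall i, measurable (B i)) ->
  let E := \bigcap_(i in [set` J]) (Z i @^-1` B i) in
  (P ([set w | A (\big[op/idx]_(i <- s) Z i w)] `&` E) =
   P [set w | A (\big[op/idx]_(i <- s) Z i w)] * P E)%E.
Proof.
move=> Zind; elim: s J A B => [|i s IHs] J A B /=.
  move=> _ _ _ _; under eq_set do rewrite big_nil.
  have [Ai|nAi] := pselect (A idx).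
    rewrite (_ : [set _ | _] = setT); last by apply/seteqP; split=> w.
    by rewrite setTI probability_setT mul1e.
  rewrite (_ : [set _ | _] = set0); last by apply/seteqP; split=> w.
  by rewrite set0I measure0 mul0e.
move=> /andP[nis us] sJ mA mB.
have niJ : i \notin J by apply: sJ; rewrite mem_head.
set E := \bigcap_(_ in _) _.
have mE : measurable E.
  apply: fin_bigcap_measurable; first exact: finite_finpred.
  by move=> k _; exact: measurable_funPTI.
pose F w := (\big[op/idx]_(i <- s) Z i w, Z i w).
have mF : measurable_fun setT F.
  by apply: measurable_fun_pair; [exact: measurable_big_op|].
pose D := [set p : V * V | A (op p.2 p.1)].
have mD : measurable D.
  rewrite -[D]setTI.
  have := measurableT_comp measurable_op
    (measurable_fun_pair (@measurable_snd _ _ V V) (@measurable_fst _ _ V V)).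
  by move=> /(_ measurableT _ mA).
have -> : [set w | A (\big[op/idx]_(i <- i :: s) Z i w)] = F @^-1` D.
  by apply/funext => w /=; rewrite big_cons.
have mBi B' (mB' : measurable B') k : measurable (if k == i then B' else B k).
  by case: ifP.
pose F' : {mfun T >-> (V * V)%type} := mfun_Sub (mem_set mF).
have PE : P E \is a fin_num by exact: fin_num_measure.
pose p := NngNum (fine_ge0 (measure_ge0 P E)).
suff : pushforward (mrestr P mE) F D = mscale p (distribution P F') D.
  by rewrite /distribution/pushforward/mrestr/mscale/= fineK// muleC.
apply: finite_measure_eq_setX => //.
  by rewrite /= /pushforward/mrestr preimage_setT setTI ltey_eq PE.
move=> A' B' mA' mB'.
rewrite /= /distribution/pushforward/mrestr/mscale/= fineK//.
have FE : F @^-1` (A' `*` B') =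
  [set w | A' (\big[op/idx]_(i <- s) Z i w)] `&` Z i @^-1` B' by [].
rewrite -[distribution P F' _]/(P (F @^-1` (A' `*` B'))) FE -setIA.
(* The event on [Z i] is absorbed into the index set, so that the induction hypothesis on [s]
   applies: with [i |: J] on the left-hand side and, by [E2], with [i] alone on the right-hand
   side. *)
have E1 : Z i @^-1` B' `&` E = \bigcap_(k in [set` i |: J])
    (Z k @^-1` (if k == i then B' else B k)).
  apply/seteqP; split=> w.
    move=> [wi wE] k /=; rewrite in_setU1.
    by case: eqP => [->//|_ /= kJ]; exact: wE.
  move=> wE; split; first by have := wE i; rewrite /= setU11 eqxx; exact.
  move=> k kJ; have := wE k; rewrite /= setU1r//.
  by case: eqP => [ki|_]; [move: niJ; rewrite -ki kJ|exact].
have E2 : Z i @^-1` B' = \bigcap_(k in [set` [set i]%SET])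
    (Z k @^-1` (if k == i then B' else B k)).
  apply/seteqP; split=> w.
    by move=> wi k /=; rewrite inE => /eqP ->; rewrite eqxx.
  by move=> /(_ i) /=; rewrite inE eqxx; exact.
rewrite E1 IHs//; last 2 first.
  move=> k ks; rewrite in_setU1 negb_or sJ ?inE ?ks ?orbT// andbT.
  by apply: contraNneq nis => <-.
  exact: mBi.
rewrite [in RHS]E2 IHs//; last 2 first.
  by move=> k ks; rewrite inE; apply: contraNneq nis => <-.
  exact: mBi.
rewrite -E2 (Zind _ (fun k => if k == i then B' else B k)); last first.
  by move=> k _; exact: mBi.
rewrite big_setU1//= eqxx.
rewrite (eq_bigr (fun k => P (Z k @^-1` B k))); last first.
  by move=> k kJ; case: eqP => // ki; move: niJ; rewrite -ki kJ.
by rewrite -Zind// [RHS]muleC muleA.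
Qed.

End partial_products.

(** * Integrals of bounded functions, and Fubini for independent variables *)

Lemma probability_bounded_integrable (d : measure_display)
    (T : measurableType d) (R : realType) (P : probability T R) (f : T -> R)
    (K : R) :
  measurable_fun setT f -> (forall w, `|f w| <= K) ->
  P.-integrable setT (EFin \o f).
Proof.
move=> mf fK; apply: measurable_bounded_integrable => //=.
  by rewrite probability_setT ltry.
by exists K; split; [exact: num_real|move=> x Kx w _ /=; exact: le_trans (fK w) (ltW Kx)].
Qed.

(** By Tonelli, the integrals of the positive and of the negative part are measurable in [x]; the
    integral is their difference, and [fine] is measurable. *)
Lemma measurable_fun_Rintegral (d1 d2 : measure_display)
    (T1 : measurableType d1) (T2 : measurableType d2) (R : realType)
    (Q : probability T2 R) (f : T1 * T2 -> R) :
  measurable_fun setT f ->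
  measurable_fun setT (fun x => \int[Q]_y f (x, y)).
Proof.
move=> mf; have mEf : measurable_fun setT (EFin \o f : T1 * T2 -> \bar R) by exact/measurable_EFinP.
apply: (@measurableT_comp _ _ _ _ _ _ fine); first exact: fine_measurable.
have -> : (fun x => \int[Q]_y (f (x, y))%:E)%E =
    (fubini_F Q (EFin \o f)^\+ \- fubini_F Q (EFin \o f)^\-)%E.
  apply/funext => x /=; rewrite integralE /fubini_F.
  by congr (_ - _)%E; apply: eq_integral => y _; rewrite ?funeposE ?funenegE.
apply: emeasurable_funB.
  apply: measurable_fun_fubini_tonelli_F; first exact: measurable_funepos.
  by move=> x; exact: funepos_ge0.
apply: measurable_fun_fubini_tonelli_F; first exact: measurable_funeneg.
by move=> x; exact: funeneg_ge0.
Qed.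

(* [(X, Y)] has the same law under [P] as [(w, w') |-> (X w, Y w')] under [P \x P]. *)
Lemma Rintegral_independent (d d1 d2 : measure_display)
    (T : measurableType d) (T1 : measurableType d1) (T2 : measurableType d2)
    (R : realType) (P : probability T R) (X : T -> T1) (Y : T -> T2)
    (f : T1 * T2 -> R) (K : R) :
  measurable_fun setT X -> measurable_fun setT Y -> measurable_fun setT f ->
  (forall A B, measurable A -> measurable B ->
    (P ((X @^-1` A) `&` (Y @^-1` B)) = P (X @^-1` A) * P (Y @^-1` B))%E) ->
  (forall w w', `|f (X w, Y w')| <= K) ->
  \int[P]_w f (X w, Y w) = \int[P]_w \int[P]_w' f (X w, Y w').
Proof.
move=> mX mY mf XY fK.
pose F w := (X w, Y w).
pose G (v : T * T) := (X v.1, Y v.2).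
have mF : measurable_fun setT F by exact: measurable_fun_pair.
have mG : measurable_fun setT G.
  by apply: measurable_fun_pair; exact: measurableT_comp.
have mEf : measurable_fun setT (EFin \o f : T1 * T2 -> \bar R) by exact/measurable_EFinP.
have intG : (P \x P)%E.-integrable setT ((EFin \o f) \o G).
  apply: measurable_bounded_integrable => //=.
  - rewrite -setXTT product_measure1E//=.
    by rewrite [X in (X * X)%E]probability_setT mule1 ltry.
  - exact: measurableT_comp.
  - exists K; split; first exact: num_real.
    by move=> x Kx [w w'] _ /=; exact: le_trans (fK w w') (ltW Kx).
have intF : P.-integrable setT ((EFin \o f) \o F).
  apply: (@probability_bounded_integrable _ _ _ P (f \o F) K).
    exact: measurableT_comp.
  by move=> w; exact: fK.
have : (\int[P]_w (f (X w, Y w))%:E =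
        \int[P]_w \int[P]_w' (f (X w, Y w'))%:E)%E.
  transitivity (\int[pushforward P F]_v (f v)%:E)%E.
    exact/esym/(integral_pushforward mF mEf intF measurableT).
  transitivity (\int[pushforward (P \x P) G]_v (f v)%:E)%E.
    apply: eq_measure_integral => D mD _.
    apply: finite_measure_eq_setX => //=.
      by rewrite /pushforward preimage_setT probability_setT ltry.
    move=> A B mA mB; rewrite /pushforward.
    have -> : G @^-1` (A `*` B) = (X @^-1` A) `*` (Y @^-1` B) by [].
    rewrite product_measure1E -?XY//.
      by rewrite -[X @^-1` A]setTI; exact: mX.
    by rewrite -[Y @^-1` B]setTI; exact: mY.
  rewrite (integral_pushforward mG mEf intG measurableT).
  exact/esym/(integral12_prod_meas1 intG).
rewrite /Rintegral => ->; congr fine.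
apply: eq_integral => w _; rewrite fineK//.
apply: integrable_fin_num => //.
apply: (@probability_bounded_integrable _ _ _ P (fun w' => f (X w, Y w')) K) => //=.
by apply: (measurableT_comp mf); exact: measurable_fun_pair.
Qed.

(** * Hoeffding's lemma *)

Lemma is_derive_ge0_ge0 (R : realType) (f df : R -> R) (t : R) :
  (forall x : R, is_derive x 1 f (df x)) -> (forall x, 0 <= x -> 0 <= df x) ->
  f 0 = 0 -> 0 <= t -> 0 <= f t.
Proof.
move=> fdf df0 f0 t0.
have [x x0t] : exists2 x, x \in `[0, t]%R & f t - f 0 = df x * (t - 0).
  apply: MVT_segment => // x.
  apply: continuous_subspaceT => y.
  by apply/differentiable_continuous/derivable1_diffP; case: (fdf y).
rewrite f0 !subr0 => ->; rewrite mulr_ge0// df0//.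
by move: x0t; rewrite in_itv/= => /andP[].
Qed.

(* The two-point case of Hoeffding's lemma: [p t + t ^ 2 / 8 - ln (1 - p + p e^t)]
   vanishes to first order at [0] and its second derivative is
   [1 / 4 - q (1 - q)] with [q = p e^t / (1 - p + p e^t)]. *)
Lemma bernoulli_mgf_le (R : realType) (p t : R) : 0 <= p <= 1 -> 0 <= t ->
  1 - p + p * expR t <= expR (p * t + t ^+ 2 / 8).
Proof.
move=> /andP[p0 p1] t0.
pose D (x : R) : R := 1 - p + p * expR x.
have D0 x : 0 < D x.
  rewrite /D; have [->|pN0] := eqVneq p 0; first by rewrite mul0r subr0 addr0.
  by rewrite ltr_wpDl ?subr_ge0// mulr_gt0 ?expR_gt0// lt_neqAle eq_sym pN0.
have D1 (x : R) : is_derive x 1 D (p * expR x).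
  rewrite /D; apply: is_derive_eq; rewrite /GRing.scale/=; ring.
(* The derivative of [F] below, with [q = p e^x / D x] written as [1 - (1 - p) / D x], so that only
   the inverse of [D] has to be differentiated again. *)
pose G (x : R) : R := p + x / 4 - 1 + (1 - p) * (D x)^-1.
have G0 x : 0 <= x -> 0 <= G x.
  pose dG (x : R) : R := 4^-1 - (1 - p) * (p * expR x) / D x ^+ 2.
  apply: (@is_derive_ge0_ge0 _ G dG).
  - move=> y; rewrite /G.
    have DV : is_derive y 1 (fun z => (D z)^-1) (- (D y) ^- 2 *: (p * expR y)).
      by apply: is_deriveV; rewrite gt_eqF.
    apply: is_derive_eq; rewrite /dG /GRing.scale/=; ring.
  - move=> y _; rewrite /dG subr_ge0 ler_pdivrMr ?exprn_gt0// ler_pdivlMl//.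
    (* This is [q (1 - q) <= 1 / 4] in the form [(a + b)^2 - 4 a b = (a - b)^2], with [a = 1 - p]
       and [b = p e^y]. *)
    rewrite -subr_ge0 (_ : _ - _ = ((1 - p) - p * expR y) ^+ 2) ?sqr_ge0//.
    by rewrite /D; ring.
  - by rewrite /G /D expR0 mulr1 subrK invr1; ring.
pose F (x : R) : R := p * x + x ^+ 2 / 8 - ln (D x).
have : 0 <= F t.
  apply: (@is_derive_ge0_ge0 _ F G).
  - move=> y; rewrite /F.
    have Dl : is_derive y 1 (fun z => ln (D z)) ((D y)^-1 * (p * expR y)).
      by apply: (@is_derive1_comp _ (@ln R) D); exact: is_derive1_ln.
    apply: is_derive_eq; rewrite /G /GRing.scale/=.
    rewrite (_ : p * expR y = D y - (1 - p)); last by rewrite /D; ring.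
    field; rewrite gt_eqF//.
  - exact: G0.
  - by rewrite /F /D expR0 mulr1 subrK ln1; ring.
  - exact: t0.
rewrite /F subr_ge0 -ler_expR lnK//; exact: D0.
Qed.

(** The exponential lies above its tangent at [z]; in the weighted sum of the tangent bounds at [A]
    and [B] the linear terms cancel. *)
Lemma expR_chord (R : realType) (q A B : R) : 0 <= q <= 1 ->
  expR ((1 - q) * A + q * B) <= (1 - q) * expR A + q * expR B.
Proof.
move=> /andP[q0 q1]; set z := _ + q * B.
have tangent x : expR z * (1 + (x - z)) <= expR x.
  have -> : expR x = expR z * expR (x - z) by rewrite -expRD addrC subrK.
  by rewrite ler_pM2l ?expR_gt0// expR_ge1Dx.
have hA : (1 - q) * (expR z * (1 + (A - z))) <= (1 - q) * expR A.
  by rewrite ler_wpM2l ?subr_ge0.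
have hB : q * (expR z * (1 + (B - z))) <= q * expR B by rewrite ler_wpM2l.
apply: le_trans (lerD hA hB); rewrite le_eqVlt; apply/orP; left; apply/eqP.
by rewrite /z; ring.
Qed.

Section hoeffding.
Context (d : measure_display) (T : measurableType d) (R : realType)
  (P : probability T R).

Lemma Rintegral_probability_cst (r : R) : \int[P]_w r = r.
Proof. by rewrite Rintegral_cst//= [X in fine X]probability_setT mulr1. Qed.

Lemma bounded_range_normr_le (X : T -> R) (c : R) (w w0 : T) :
  (forall w w', `|X w - X w'| <= c) -> `|X w| <= `|X w0| + c.
Proof.
move=> Xc; rewrite -[X w](subrK (X w0)) addrC.
by rewrite (le_trans (ler_normD _ _))// lerD2l.
Qed.

Lemma bounded_range_integrable (X : T -> R) (c : R) :
  measurable_fun setT X -> (forall w w', `|X w - X w'| <= c) ->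
  P.-integrable setT (EFin \o X).
Proof.
move=> mX Xc; apply: (probability_bounded_integrable _ mX) => w.
exact: (bounded_range_normr_le _ point Xc).
Qed.

Lemma bounded_range_integrable_expR (X : T -> R) (c l : R) :
  measurable_fun setT X -> (forall w w', `|X w - X w'| <= c) -> 0 <= l ->
  P.-integrable setT (EFin \o (fun w => expR (l * X w))).
Proof.
move=> mX Xc l0.
apply: (@probability_bounded_integrable _ _ _ _ _ (expR (l * (`|X point| + c)))).
  by apply: measurableT_comp => //; exact: measurable_funM.
move=> w; rewrite ger0_norm ?expR_ge0// ler_expR ler_wpM2l//.
exact: le_trans (ler_norm _) (bounded_range_normr_le _ point Xc).
Qed.

(** The values of [X] lie in [[a, a + c]] with [a] their infimum. Replacing the exponential by its
    chord there reduces the claim to a variable with values [a] and [a + c] and the same mean, which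
    is the Bernoulli case rescaled. *)
Lemma hoeffding_lemma (X : T -> R) (c l : R) :
  measurable_fun setT X -> (forall w w', `|X w - X w'| <= c) -> 0 <= l ->
  \int[P]_w expR (l * X w) <=
  expR (l * \int[P]_w X w + l ^+ 2 / 8 * c ^+ 2).
Proof.
move=> mX Xc l0; pose a := inf (range X).
have c0 : 0 <= c by apply: le_trans (Xc point point); rewrite normr_ge0.
have lbX w0 : lbound (range X) (X w0 - c).
  by move=> _ [w _ <-]; rewrite lerBlDr -lerBlDl (le_trans (ler_norm _)).
have aX w : a <= X w by apply: ge_inf; [exists (X point - c)|exists w].
have Xa w : X w <= a + c.
  by rewrite -lerBlDr; apply: lb_le_inf; [exists (X point), point|exact: lbX].
have iX := bounded_range_integrable mX Xc.
have ieX := bounded_range_integrable_expR mX Xc l0.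
have icst (r : R) : P.-integrable setT (EFin \o cst r).
  by apply: (@probability_bounded_integrable _ _ _ _ _ `|r|).
set E := \int[P]_w X w.
have aE : a <= E.
  by rewrite -(Rintegral_probability_cst a); apply: le_Rintegral => //; exact: icst.
have Ea : E <= a + c.
  by rewrite -(Rintegral_probability_cst (a + c)); apply: le_Rintegral => //; exact: icst.
(* The chord has slope with denominator [c]; for [c = 0] the variable is constant. *)
have [cE|cN0] := eqVneq c 0.
  have Xcst w : X w = a.
    by apply/eqP; rewrite eq_le aX andbT; have := Xa w; rewrite cE addr0.
  have Ecst : E = a by apply/eqP; rewrite eq_le aE andbT -[leRHS]addr0 -cE.
  under eq_Rintegral do rewrite Xcst.
  by rewrite Rintegral_probability_cst Ecst cE expr0n mulr0 addr0.
have {c0 cN0} c0 : 0 < c by rewrite lt_neqAle eq_sym cN0.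
pose eA := expR (l * a); pose eB := expR (l * (a + c)).
(* Intercept and slope of the chord of [x |-> e^(l x)] over [[a, a + c]]. *)
pose al := ((a + c) * eA - a * eB) / c; pose be := (eB - eA) / c.
have chord w : expR (l * X w) <= al + be * X w.
  pose q := (X w - a) / c.
  have q01 : 0 <= q <= 1.
    by rewrite divr_ge0 ?subr_ge0 ?(ltW c0)//= ler_pdivrMr// mul1r lerBlDl.
  have := expR_chord (l * a) (l * (a + c)) q01.
  congr (expR _ <= _); rewrite /q /al /be -/eA -/eB; field; exact: lt0r_neq0.
have ibX : P.-integrable setT (EFin \o (fun w => be * X w)).
  exact: (integrableZl measurableT be iX).
apply: (@le_trans _ _ (\int[P]_w (al + be * X w))).
  apply: le_Rintegral => //.
  by have := integrableD measurableT (icst al) ibX.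
rewrite RintegralD//; last exact: icst.
rewrite Rintegral_probability_cst RintegralZl// -/E.
(* The weight of [a + c] in the two-point law with mean [E]; the integrated chord [al + be * E]
   equals [e^(l a) (1 - p + p e^(l c))]. *)
pose p := (E - a) / c.
have p01 : 0 <= p <= 1.
  by rewrite divr_ge0 ?subr_ge0 ?(ltW c0)//= ler_pdivrMr// mul1r lerBlDl.
have := bernoulli_mgf_le p01 (mulr_ge0 l0 (ltW c0)).
rewrite -(ler_pM2l (expR_gt0 (l * a))) -expRD.
congr (_ <= expR _); last first.
  by rewrite /p; field; exact: lt0r_neq0.
have eBE : eB = eA * expR (l * c) by rewrite /eB mulrDr expRD.
rewrite /p /al /be eBE -/eA; field; exact: lt0r_neq0.
Qed.

End hoeffding.

(** * Mean deviation and upper tail from a bound on the moment generating function *)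

(* With [L = t ^ 2 v / 8], integrate
   [1 + (t |x| - L) <= e^(t |x| - L) <= (e^(t x) + e^(- t x)) e^(- L)]
   and take [t = 2 / sqrt v]. *)
Lemma Rintegral_norm_le_mgf (d : measure_display) (T : measurableType d)
    (R : realType) (P : probability T R) (X : T -> R) (K v : R) :
  measurable_fun setT X -> (forall w, `|X w| <= K) -> 0 <= v ->
  (forall t, 0 <= t -> \int[P]_w expR (t * X w) <= expR (t ^+ 2 / 8 * v)) ->
  (forall t, 0 <= t -> \int[P]_w expR (t * - X w) <= expR (t ^+ 2 / 8 * v)) ->
  \int[P]_w `|X w| <= 3 / 4 * Num.sqrt v.
Proof.
move=> mX XK v0 mgf mgfN.
have iaX : P.-integrable setT (EFin \o (fun w => `|X w|)).
  apply: (@probability_bounded_integrable _ _ _ _ _ K).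
    exact: measurableT_comp.
  by move=> w; rewrite normr_id.
have icst (r : R) : P.-integrable setT (EFin \o cst r).
  by apply: (@probability_bounded_integrable _ _ _ _ _ `|r|).
have ie (t : R) (X' : T -> R) : 0 <= t -> measurable_fun setT X' ->
    (forall w, `|X' w| <= K) ->
    P.-integrable setT (EFin \o (fun w => expR (t * X' w))).
  move=> t0 mX' X'K.
  apply: (@probability_bounded_integrable _ _ _ _ _ (expR (t * K))).
    by apply: measurableT_comp => //; exact: measurable_funM.
  move=> w; rewrite ger0_norm ?expR_ge0// ler_expR ler_wpM2l//.
  exact: le_trans (ler_norm _) (X'K w).
set E := \int[P]_w _.
have tE t : 0 <= t -> t * E <= 1 + t ^+ 2 / 8 * v.
  move=> t0; set L := t ^+ 2 / 8 * v.
  have ie1 := ie t X t0 mX XK.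
  have ie2 : P.-integrable setT (EFin \o (fun w => expR (t * - X w))).
    apply: (ie t (\- X)) => //; first exact: measurable_funN.
    by move=> w; rewrite normrN.
  have ie12 : P.-integrable setT
      (EFin \o (fun w => expR (t * X w) + expR (t * - X w))).
    exact: (integrableD measurableT ie1 ie2).
  have ie3 : P.-integrable setT (EFin \o
      (fun w => expR (- L) * (expR (t * X w) + expR (t * - X w)))).
    exact: (integrableZl measurableT (expR (- L)) ie12).
  rewrite /E -RintegralZl//.
  apply: (@le_trans _ _ (\int[P]_w (L - 1 +
      expR (- L) * (expR (t * X w) + expR (t * - X w))))).
    apply: le_Rintegral => //.
    - exact: (integrableZl measurableT t iaX).
    - exact: (integrableD measurableT (icst (L - 1)) ie3).
    move=> w _; rewrite -lerBlDl.
    apply: (@le_trans _ _ (expR (- L) * expR (t * `|X w|))).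
      rewrite -expRD; apply: le_trans (expR_ge1Dx _); lra.
    rewrite ler_pM2l ?expR_gt0//.
    have [X0|X0] := leP 0 (X w).
      by rewrite ger0_norm// lerDl expR_ge0.
    by rewrite ltr0_norm// lerDr expR_ge0.
  rewrite RintegralD//; last exact: icst.
  rewrite Rintegral_probability_cst RintegralZl// RintegralD//.
  have : expR (- L) * (\int[P]_x expR (t * X x) + \int[P]_x expR (t * - X x))
      <= expR (- L) * (expR L + expR L).
    rewrite ler_pM2l ?expR_gt0//.
    exact: lerD (mgf t t0) (mgfN t t0).
  rewrite (_ : expR (- L) * (expR L + expR L) = 2); first lra.
  by rewrite mulrDr -expRD addNr expR0.
have [v_eq0|v_neq0] := eqVneq v 0.
  rewrite v_eq0 sqrtr0 mulr0 leNgt; apply/negP => E0.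
  (* For [v = 0] the bound reads [t E <= 1] for every [t >= 0], which [t = 2 / E] refutes. *)
  have := tE (2 / E) (divr_ge0 (ler0n _ 2) (ltW E0)); rewrite v_eq0 mulr0 addr0 divfK ?gt_eqF//; lra.
have s0 : 0 < Num.sqrt v by rewrite sqrtr_gt0 lt_neqAle eq_sym v_neq0.
(* At this [t] the right-hand side is [1 + (4 / v) v / 8 = 3 / 2], whence the constant [3 / 4]. *)
have := tE (2 / Num.sqrt v) (divr_ge0 (ler0n _ _) (ltW s0)).
rewrite -{3}(sqr_sqrtr v0).
rewrite (_ : 1 + _ = 3 / 2); last by field; rewrite gt_eqF.
rewrite mulrAC ler_pdivrMr//; lra.
Qed.

Lemma chernoff_subgaussian (d : measure_display) (T : measurableType d)
    (R : realType) (P : probability T R) (X : T -> R) (K v delta : R) :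
  measurable_fun setT X -> (forall w, `|X w| <= K) -> 0 <= v -> 0 < delta ->
  (forall t, 0 <= t -> \int[P]_w expR (t * X w) <= expR (t ^+ 2 / 8 * v)) ->
  (P [set w | delta <= X w]%R <= expeR (- ((2 * delta ^+ 2)%:E / v%:E)))%E.
Proof.
move=> mX XK v0 delta0 mgf.
have bound t : 0 < t ->
    (P [set w | delta <= X w]%R <= (expR (t ^+ 2 / 8 * v - t * delta))%:E)%E.
  move=> t0.
  pose X' : {RV P >-> R} := mfun_Sub (mem_set mX).
  apply: (le_trans (chernoff X' delta t0)).
  rewrite expRD EFinM lee_pmul2r//; last by rewrite lte_fin expR_gt0.
  apply: le_trans (_ : (\int[P]_w expR (t * X w))%:E <= _)%E; last first.
    by rewrite lee_fin mgf ?ltW.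
  rewrite /mmt_gen_fun unlock /Rintegral fineK.
    by under eq_integral do rewrite /= mulrC.
  apply: integrable_fin_num => //.
  apply: (@probability_bounded_integrable _ _ _ _ _ (expR (t * K))).
    by apply: measurableT_comp => //; exact: measurable_funM.
  move=> w; rewrite ger0_norm ?expR_ge0// ler_expR ler_pM2l//.
  exact: le_trans (ler_norm _) (XK w).
have mE : measurable [set w | delta <= X w].
  rewrite -[X in measurable X]setTI.
  rewrite (_ : [set w | _] = X @^-1` `[delta, +oo[); first exact: mX.
  by apply/seteqP; split=> w /=; rewrite in_itv/= andbT.
have [v_eq0|v_neq0] := eqVneq v 0; last first.
  rewrite inver (negbTE v_neq0) -EFinM -EFinN/=.
  have {}v0 : 0 < v by rewrite lt_neqAle eq_sym v_neq0.
  (* The minimiser of [t^2 v / 8 - t delta], with minimum [- 2 delta^2 / v]. *)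
  apply: (le_trans (bound (4 * delta / v) _)); first by rewrite divr_gt0// mulr_gt0.
  rewrite lee_fin ler_expR le_eqVlt; apply/orP; left; apply/eqP.
  by field; rewrite gt_eqF.
(* For [v = 0] the right-hand side is [exp (-oo) = 0], so the event must be shown to be null. *)
rewrite v_eq0 inve0 gt0_muley ?lte_fin ?mulr_gt0 ?exprn_gt0//=.
have PE : P [set w | delta <= X w] \is a fin_num by exact: fin_num_measure.
rewrite -(fineK PE) lee_fin leNgt; apply/negP => p0.
set p := fine _ in p0.
(* If [p > 0], this [t] gives [p <= e^(- 1 / p)], contradicting [e^(1 / p) > 1 / p]. *)
have := bound (p^-1 / delta); rewrite divr_gt0 ?invr_gt0// => /(_ isT).
rewrite -(fineK PE) lee_fin -/p v_eq0 mulr0 sub0r divfK ?gt_eqF// expRN.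
apply/negP; rewrite -ltNge invf_plt ?posrE ?expR_gt0//.
by apply: lt_le_trans (expR_ge1Dx _); rewrite ltrDr.
Qed.

(** * McDiarmid's inequality for functions of a sum in a commutative monoid *)

Section bounded_differences.
Context (d d' : measure_display) (T : measurableType d) (V : measurableType d')
  (R : realType) (P : probability T R) (I : finType) (Z : I -> {RV P >-> V})
  (idx : V) (op : Monoid.com_law idx).
Hypothesis measurable_op : measurable_fun setT (fun p : V * V => op p.1 p.2).
Hypothesis Z_independent : mutually_independent Z.

(** The remainder [x] ranges over all of [V], not only over attained partial sums: a further summand
    can then be moved into [x], which is how the property passes to averages of [g]. *)
Definition bounded_differences (s : seq I) (c : I -> R) (g : V -> R) :=
  {in s, forall i x w w', `|g (op x (Z i w)) - g (op x (Z i w'))| <= c i}.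

Lemma bounded_differences_cons (i : I) (s : seq I) (c : I -> R) (g : V -> R) :
  bounded_differences (i :: s) c g ->
  (forall x w w', `|g (op x (Z i w)) - g (op x (Z i w'))| <= c i) /\
  bounded_differences s c g.
Proof.
move=> gc; split; first by apply: gc; rewrite mem_head.
by move=> k ks; apply: gc; rewrite inE ks orbT.
Qed.

(** The summands are switched from [w] to [w'] one at a time, each switch costing [c i]; [x]
    collects those already switched. *)
Lemma bounded_differences_range (s : seq I) (c : I -> R) (g : V -> R) x w w' :
  bounded_differences s c g ->
  `|g (op x (\big[op/idx]_(i <- s) Z i w)) -
    g (op x (\big[op/idx]_(i <- s) Z i w'))| <= \sum_(i <- s) c i.
Proof.
elim: s x => [|i s IHs] x; first by rewrite !big_nil subrr normr0.
move=> /bounded_differences_cons[gi /IHs gs]; rewrite !big_cons.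
rewrite (le_trans (ler_distD (g (op x (op (Z i w')
  (\big[op/idx]_(i <- s) Z i w)))) _ _))// lerD//.
  rewrite [op (Z i w) _]Monoid.mulmC [op (Z i w') _]Monoid.mulmC !Monoid.mulmA.
  exact: gi.
by rewrite !Monoid.mulmA; exact: gs.
Qed.

(** The induction is over [s] with [g] general, since the hypothesis is applied to the average [h]
    of [g] over [Z i]. Hoeffding's lemma, applied with the value of [S] frozen, contributes the term
    [c i ^+ 2]. *)
Lemma mgf_bounded_differences (s : seq I) (c : I -> R) (g : V -> R) (l : R) :
  uniq s -> measurable_fun setT g -> bounded_differences s c g -> 0 <= l ->
  \int[P]_w expR (l * g (\big[op/idx]_(i <- s) Z i w)) <=
  expR (l * \int[P]_w g (\big[op/idx]_(i <- s) Z i w) +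
        l ^+ 2 / 8 * \sum_(i <- s) c i ^+ 2).
Proof.
elim: s g => [|i s IHs] g.
  move=> _ _ _ _; under eq_Rintegral do rewrite big_nil.
  under [X in _ <= expR (l * X + _)]eq_Rintegral do rewrite big_nil.
  by rewrite !Rintegral_probability_cst big_nil mulr0 addr0.
move=> /= /andP[nis us] mg /[dup] gis /bounded_differences_cons[gi gs] l0.
pose S w := \big[op/idx]_(i <- s) Z i w.
have mS : measurable_fun setT S by exact: measurable_big_op.
have SE w : \big[op/idx]_(i <- i :: s) Z i w = op (S w) (Z i w).
  by rewrite big_cons Monoid.mulmC.
under eq_Rintegral do rewrite SE.
under [X in _ <= expR (l * X + _)]eq_Rintegral do rewrite SE.
have mgop : measurable_fun setT (fun p : V * V => g (op p.1 p.2)).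
  exact: (measurableT_comp mg measurable_op).
(* A bound valid even when [S] and [Z i] are evaluated at different sample points, as the iterated
   integrals require. *)
pose K := `|g (op (S point) (Z i point))| + (c i + \sum_(i <- s) c i).
have gK w w' : `|g (op (S w) (Z i w'))| <= K.
  rewrite -[g _](subrK (g (op (S point) (Z i point)))) addrC.
  rewrite (le_trans (ler_normD _ _))// lerD2l.
  rewrite (le_trans (ler_distD (g (op (S w) (Z i point))) _ _))// lerD//.
  rewrite [op (S w) _]Monoid.mulmC [op (S point) _]Monoid.mulmC.
  exact: bounded_differences_range.
have indep A B : measurable A -> measurable B ->
    (P ((S @^-1` A) `&` (Z i @^-1` B)) = P (S @^-1` A) * P (Z i @^-1` B))%E.
  move=> mA mB.
  have := @mutually_independent_big_op _ _ _ _ _ _ _ Z _ _ measurable_op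
    s [set i]%SET A (fun=> B) Z_independent us _ mA (fun=> mB).
  rewrite /= (_ : [set` [set i]%SET] = [set i]); last first.
    by apply/seteqP; split=> k /=; rewrite inE => /eqP.
  rewrite bigcap_set1; apply=> k ks; rewrite inE.
  by apply: contraNneq nis => <-.
pose h x := \int[P]_w g (op x (Z i w)).
have mgx x : measurable_fun setT (fun w => g (op x (Z i w))).
  have mx : measurable_fun setT (fun w => (x, Z i w)).
    exact: measurable_fun_pair.
  exact: (measurableT_comp mgop mx).
have igx x : P.-integrable setT (EFin \o (fun w => g (op x (Z i w)))).
  exact: (bounded_range_integrable P (mgx x) (gi x)).
have mgZ : measurable_fun setT (fun p : V * T => g (op p.1 (Z i p.2))).
  have mZ : measurable_fun setT (fun p : V * T => (p.1, Z i p.2)).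
    by apply: measurable_fun_pair => //; exact: measurableT_comp.
  exact: (measurableT_comp mgop mZ).
have mh : measurable_fun setT h by exact: measurable_fun_Rintegral mgZ.
have hs : bounded_differences s c h.
  move=> k ks x w w'; rewrite /h -RintegralB//.
  have opAC v a : op (op x (Z k a)) (Z i v) = op (op x (Z i v)) (Z k a).
    by rewrite Monoid.mulmAC.
  apply: le_trans (le_normr_Rintegral measurableT _) _.
    exact: (integrableB measurableT (igx _) (igx _)).
  rewrite -(Rintegral_probability_cst P (c k)).
  apply: le_Rintegral => //.
  - apply: (@probability_bounded_integrable _ _ _ _ _ (c k)).
      apply: measurableT_comp => //; exact: measurable_funB.
    by move=> v; rewrite normr_id !opAC; exact: gs.
  - by apply: (@probability_bounded_integrable _ _ _ _ _ `|c k|).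
  - by move=> v _; rewrite !opAC; exact: gs.
(* Independence turns the mean of [g] into the mean of [h] at [S], and then the exponential moment
   into an iterated integral. *)
rewrite (Rintegral_independent (f := fun p : V * V => g (op p.1 p.2)) mS _ mgop indep gK)//.
rewrite (@Rintegral_independent _ _ _ _ _ _ _ P S (Z i)
  (fun p : V * V => expR (l * g (op p.1 p.2))) (expR (l * K)) mS _ _ indep)//;
  last 2 first.
- by apply: measurableT_comp => //; exact: measurable_funM.
- move=> w w' /=; rewrite ger0_norm ?expR_ge0// ler_expR ler_wpM2l//.
  exact: le_trans (ler_norm _) (gK _ _).
have {}IHs := IHs h us mh hs l0.
rewrite big_cons mulrDr addrCA expRD.
apply: le_trans (ler_wpM2l (expR_ge0 _) IHs).
have ihS : P.-integrable setT (EFin \o (fun w => expR (l * h (S w)))).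
  apply: (@bounded_range_integrable_expR _ _ _ P (h \o S)
    (\sum_(i <- s) c i)) => //; first exact: measurableT_comp.
  move=> w w' /=; rewrite -[S w](Monoid.mul1m op) -[S w'](Monoid.mul1m op).
  exact: bounded_differences_range.
have inner w : \int[P]_w' expR (l * g (op (S w) (Z i w'))) <=
    expR (l ^+ 2 / 8 * c i ^+ 2) * expR (l * h (S w)).
  by rewrite -expRD addrC; exact: hoeffding_lemma.
have ihSZ : P.-integrable setT (EFin \o
    (fun w => expR (l ^+ 2 / 8 * c i ^+ 2) * expR (l * h (S w)))).
  exact: (integrableZl measurableT _ ihS).
rewrite -RintegralZl//; apply: le_Rintegral => //; last first.
  by move=> w _; exact: inner.
(* Integrability of the inner integral follows by domination from the bound [inner] itself. *)
apply: le_integrable ihSZ => //.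
  apply/measurable_EFinP.
  apply: (measurableT_comp
    (f := fun x => \int[P]_w expR (l * g (op x (Z i w)))) _ mS).
  apply: (@measurable_fun_Rintegral _ _ _ _ _ P
    (fun p : V * T => expR (l * g (op p.1 (Z i p.2))))).
  by apply: measurableT_comp => //; exact: measurable_funM.
move=> w _ /=; rewrite lee_fin ger0_norm.
  by rewrite ger0_norm// mulr_ge0// expR_ge0.
by apply: Rintegral_ge0 => w' _; rewrite expR_ge0.
Qed.

Section concentration.
Context (s : seq I) (c : I -> R) (g : V -> R).
Hypotheses (uniq_s : uniq s) (measurable_g : measurable_fun setT g)
  (g_bounded : bounded_differences s c g).

Let X w := g (\big[op/idx]_(i <- s) Z i w).

Let measurable_X : measurable_fun setT X.
Proof. exact: (measurableT_comp measurable_g (measurable_big_op Z measurable_op s)). Qed.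

Let X_range w w' : `|X w - X w'| <= \sum_(i <- s) c i.
Proof.
have := bounded_differences_range idx w w' g_bounded.
by rewrite !Monoid.mul1m.
Qed.

Lemma bounded_differences_integrable : P.-integrable setT (EFin \o X).
Proof. exact: (bounded_range_integrable P measurable_X X_range). Qed.

Lemma centered_mgf_bounded_differences (t : R) : 0 <= t ->
  \int[P]_w expR (t * (X w - \int[P]_w X w)) <=
  expR (t ^+ 2 / 8 * \sum_(i <- s) c i ^+ 2).
Proof.
move=> t0; have := mgf_bounded_differences uniq_s measurable_g g_bounded t0.
rewrite -/X expRD -ler_pdivrMl ?expR_gt0// -expRN -(RintegralZl (expR _))//; last first.
  exact: (bounded_range_integrable_expR P measurable_X X_range t0).
apply: le_trans; rewrite le_eqVlt; apply/orP; left; apply/eqP.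
by apply: eq_Rintegral => w _; rewrite -expRD mulrBr addrC.
Qed.

End concentration.

Section tail_and_mean_deviation.
Context (s : seq I) (c : I -> R) (g : V -> R).
Hypotheses (uniq_s : uniq s) (measurable_g : measurable_fun setT g)
  (g_bounded : bounded_differences s c g).

Let X w := g (\big[op/idx]_(i <- s) Z i w) -
  \int[P]_w g (\big[op/idx]_(i <- s) Z i w).

Let measurable_X : measurable_fun setT X.
Proof.
apply: measurable_funB => //.
exact: (measurableT_comp measurable_g (measurable_big_op Z measurable_op s)).
Qed.

Let X_bounded w : `|X w| <= `|X point| + \sum_(i <- s) c i.
Proof.
apply: bounded_range_normr_le => v v'; rewrite /X opprB addrA subrK.
have := bounded_differences_range idx v v' g_bounded.
by rewrite !Monoid.mul1m.
Qed.

Let sum_sqr_ge0 : 0 <= \sum_(i <- s) c i ^+ 2.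
Proof. by apply: sumr_ge0 => i _; rewrite sqr_ge0. Qed.

Lemma mcdiarmid (delta : R) : 0 < delta ->
  (P [set w | delta <= X w]%R <=
   expeR (- ((2 * delta ^+ 2)%:E / (\sum_(i <- s) c i ^+ 2)%:E)))%E.
Proof.
move=> delta0.
apply: (chernoff_subgaussian measurable_X X_bounded sum_sqr_ge0 delta0) => t t0.
exact: centered_mgf_bounded_differences.
Qed.

Lemma mean_deviation_bounded_differences :
  \int[P]_w `|X w| <= 3 / 4 * Num.sqrt (\sum_(i <- s) c i ^+ 2).
Proof.
apply: (Rintegral_norm_le_mgf measurable_X X_bounded sum_sqr_ge0) => t t0.
  exact: centered_mgf_bounded_differences.
(* The exponential moment of [- X] is that of the centered variable built from [- g]. *)
have gN : bounded_differences s c (\- g).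
  by move=> i /g_bounded gi x w w'; rewrite /= opprK addrC gi.
have := centered_mgf_bounded_differences uniq_s (measurable_funN measurable_g)
  gN t0.
apply: le_trans; rewrite le_eqVlt; apply/orP; left; apply/eqP.
apply: eq_Rintegral => w _; congr (expR (t * _)).
rewrite /X opprB [RHS]addrC; congr (_ - _).
rewrite -mulN1r -RintegralZl//.
  by apply: eq_Rintegral => v _; rewrite /= mulN1r opprK.
exact: (bounded_differences_integrable (measurable_funN measurable_g) gN).
Qed.

End tail_and_mean_deviation.

End bounded_differences.

(** * Vectors: addition, clamping and the 1-norm *)

Section vectors.
Context (R : realType) (m : nat).

Definition vec_zero : m.-tuple R := [tuple 0 | j < m].

(** Together with [vec_zero] it forms the commutative monoid to which the bounded difference results
    are applied. *)
Definition vec_add (x y : m.-tuple R) : m.-tuple R :=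
  [tuple tnth x j + tnth y j | j < m].

(* Clamping [Y_i] turns its almost sure bounds into pointwise ones without changing
   it outside a null set. *)
Definition vec_clamp (l u x : m.-tuple R) : m.-tuple R :=
  [tuple Num.max (tnth l j) (Num.min (tnth u j) (tnth x j)) | j < m].

Lemma vec_addA : associative vec_add.
Proof. by move=> x y z; apply: eq_from_tnth => j; rewrite !tnth_mktuple addrA. Qed.

Lemma vec_addC : commutative vec_add.
Proof. by move=> x y; apply: eq_from_tnth => j; rewrite !tnth_mktuple addrC. Qed.

Lemma vec_add0 : left_id vec_zero vec_add.
Proof. by move=> x; apply: eq_from_tnth => j; rewrite !tnth_mktuple add0r. Qed.

HB.instance Definition _ :=
  Monoid.isComLaw.Build (m.-tuple R) vec_zero vec_add vec_addA vec_addC vec_add0.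

Lemma tnth_vec_add x y j : tnth (vec_add x y) j = tnth x j + tnth y j.
Proof. by rewrite tnth_mktuple. Qed.

Lemma tnth_big_vec_add (I : Type) (s : seq I) (v : I -> m.-tuple R) j :
  tnth (\big[vec_add/vec_zero]_(i <- s) v i) j = \sum_(i <- s) tnth (v i) j.
Proof.
elim: s => [|i s IHs]; first by rewrite !big_nil tnth_mktuple.
by rewrite !big_cons tnth_vec_add IHs.
Qed.

Lemma measurable_vec_add :
  measurable_fun setT (fun p : m.-tuple R * m.-tuple R => vec_add p.1 p.2).
Proof.
apply/measurable_fun_tnthP => j; rewrite /comp.
under eq_fun do rewrite tnth_mktuple.
apply: measurable_funD.
  exact: (measurableT_comp (measurable_tnth j) measurable_fst).
exact: (measurableT_comp (measurable_tnth j) measurable_snd).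
Qed.

Lemma measurable_vec_clamp (l u : m.-tuple R) :
  measurable_fun setT (vec_clamp l u).
Proof.
apply/measurable_fun_tnthP => j; rewrite /comp.
under eq_fun do rewrite tnth_mktuple.
apply: measurable_maxr => //; apply: measurable_minr => //.
exact: measurable_tnth.
Qed.

HB.instance Definition _ (l u : m.-tuple R) :=
  isMeasurableFun.Build _ _ _ _ (vec_clamp l u) (measurable_vec_clamp l u).

Lemma measurable_norm1_sub (a : m.-tuple R) :
  measurable_fun setT (fun x => norm1 (vec_sub x a)).
Proof.
rewrite /norm1; apply: measurable_sum => j; apply: measurableT_comp => //.
under eq_fun do rewrite tnth_mktuple.
by apply: measurable_funB => //; exact: measurable_tnth.
Qed.

Lemma norm1_sub_lipschitz (a x y : m.-tuple R) :
  `|norm1 (vec_sub x a) - norm1 (vec_sub y a)| <=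
  \sum_(j < m) `|tnth x j - tnth y j|.
Proof.
rewrite /norm1 -sumrB (le_trans (ler_norm_sum _ _ _))// ler_sum// => j _.
rewrite !tnth_mktuple (le_trans (ler_dist_dist _ _))//.
by rewrite opprB addrA subrK.
Qed.

Lemma vec_clamp_dist (l u x y : m.-tuple R) j : tnth l j <= tnth u j ->
  `|tnth (vec_clamp l u x) j - tnth (vec_clamp l u y) j| <=
  tnth u j - tnth l j.
Proof.
move=> lu; rewrite !tnth_mktuple.
have clamp z : tnth l j <= Num.max (tnth l j) (Num.min (tnth u j) z) <= tnth u j.
  by rewrite le_max lexx/= ge_max lu ge_min lexx.
move: (clamp (tnth x j)) (clamp (tnth y j)) => /andP[? ?] /andP[? ?].
rewrite ler_norml; apply/andP; split; lra.
Qed.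

Lemma vec_clamp_id (l u x : m.-tuple R) :
  (forall j, tnth l j <= tnth x j <= tnth u j) -> vec_clamp l u x = x.
Proof.
move=> lxu; apply: eq_from_tnth => j; rewrite tnth_mktuple.
by have /andP[lx xu] := lxu j; rewrite min_r// max_r.
Qed.

End vectors.

(** * Passage to clamped variables and the conclusion *)

Lemma Rintegral_sum (d : measure_display) (T : measurableType d) (R : realType)
    (mu : {measure set T -> \bar R}) (I : Type) (s : seq I) (f : I -> T -> R) :
  (forall i, mu.-integrable setT (EFin \o f i)) ->
  \int[mu]_x (\sum_(i <- s) f i x) = \sum_(i <- s) \int[mu]_x f i x.
Proof.
move=> fint; rewrite /Rintegral; under eq_integral do rewrite -sumEFin.
rewrite (integral_sum measurableT (f := fun i x => (f i x)%:E))//.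
by rewrite -EFin_sum_fine// => i _; exact: (integrable_fin_num measurableT (fint i)).
Qed.

(* The quotient in the exponent is taken in the extended reals, where
   c / 0 = +oo for c > 0: in the degenerate case of a zero denominator the
   right-hand side is 2 * exp(-oo) = 0. *)
Theorem theorem11 (R : realType) (d : measure_display) (T : measurableType d)
    (P : probability T R) (n m : nat)
    (Y : 'I_n -> {RV P >-> m.-tuple R}) (l u : 'I_n -> m.-tuple R)
    (Y_indep : mutually_independent Y)
    (Y_bounded : forall (i : 'I_n) (j : 'I_m),
      P [set w | tnth (l i) j <= tnth (Y i w) j <= tnth (u i) j] = 1%E)
    (delta : R) (delta_gt0 : 0 < delta) :
  let Ysum := fun w : T => vec_sum (fun i : 'I_n => Y i w) in
  let mu := vec_expectation P Ysum in
  (P [set w | (norm1 (vec_sub (Ysum w) mu) >=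
                (112%:R / 100%:R) *
                  (\sum_(j < m) Num.sqrt
                     (\sum_(i < n) (tnth (l i) j - tnth (u i) j) ^+ 2))
                + delta)%R]
   <= 2%:E * expeR (- ((2 * delta ^+ 2)%:E /
        (\sum_(i < n) (\sum_(j < m) (tnth (u i) j - tnth (l i) j)) ^+ 2)%:E)))%E.
Proof.
cbv zeta; set Ysum := fun w : T => vec_sum _; set mu := vec_expectation P Ysum.
have mG i j : measurable [set w | tnth (l i) j <= tnth (Y i w) j <= tnth (u i) j].
  have mYij : measurable_fun setT (fun w => tnth (Y i w) j).
    exact: (measurableT_comp (measurable_tnth j)).
  rewrite -[X in measurable X]setTI (_ : [set w | _] =
    (fun w => tnth (Y i w) j) @^-1` `[tnth (l i) j, tnth (u i) j]).
    exact: mYij.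
  by apply/seteqP; split=> w /=; rewrite in_itv.
(* Otherwise the event in [Y_bounded] would be empty while having probability 1. *)
have lu i j : tnth (l i) j <= tnth (u i) j.
  rewrite leNgt; apply/negP => ul; have := Y_bounded i j.
  rewrite (_ : [set w | _] = set0) ?measure0; last first.
    apply/seteqP; split=> w //= /andP[lY /(le_trans lY)].
    by rewrite leNgt ul.
  by move=> /eqP; rewrite eq_sym onee_eq0.
pose Z i : {RV P >-> m.-tuple R} := vec_clamp (l i) (u i) \o Y i.
have Z_indep : mutually_independent Z.
  move=> J A mA; apply: (Y_indep J (fun i => vec_clamp (l i) (u i) @^-1` A i)).
  by move=> i iJ; apply: measurable_funPTI; exact: mA.
have ZY : {ae P, forall w, forall i, Z i w = Y i w}.
  apply: filter_forall => i.
  have : {ae P, forall w, forall j, tnth (l i) j <= tnth (Y i w) j <= tnth (u i) j}.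
    apply: filter_forall => j; exists (~` [set w |
      tnth (l i) j <= tnth (Y i w) j <= tnth (u i) j]); split => //.
      exact: measurableC.
    by rewrite probability_setC// Y_bounded subee.
  by apply: filterS => w lYu; rewrite /Z/= vec_clamp_id.
pose s := index_enum 'I_n.
have us : uniq s by exact: index_enum_uniq.
pose S w := \big[@vec_add R m/@vec_zero R m]_(i <- s) Z i w.
have YsumS w : (forall i, Z i w = Y i w) -> Ysum w = S w.
  move=> ZYw; apply: eq_from_tnth => j; rewrite tnth_mktuple tnth_big_vec_add.
  by apply: eq_bigr => i _; rewrite ZYw.
have BD j : bounded_differences Z (@vec_add R m) s
    (fun i => tnth (u i) j - tnth (l i) j) (@tnth m R ^~ j).
  move=> i _ x w w'; rewrite !tnth_vec_add opprD addrACA subrr add0r.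
  exact: vec_clamp_dist.
(* [Ysum] and the clamped sum [S] agree almost everywhere, so [mu] is also the mean of [S]. *)
have muE j : tnth mu j = \int[P]_w tnth (S w) j.
  rewrite tnth_mktuple unlock /Rintegral; congr fine.
  apply: ae_eq_integral => //.
  - apply/measurable_EFinP; rewrite /Ysum.
    under eq_fun do rewrite tnth_mktuple.
    apply: measurable_sum => i.
    exact: (measurableT_comp (measurable_tnth j)).
  - apply/measurable_EFinP.
    apply: (measurableT_comp (measurable_tnth j)).
    exact: (measurable_big_op Z (@measurable_vec_add R m)).
  by apply: filterS ZY => w /YsumS -> _.
pose g (x : m.-tuple R) := norm1 (vec_sub x mu).
have mg : measurable_fun setT g by exact: measurable_norm1_sub.
have BDg : bounded_differences Z (@vec_add R m) s
    (fun i => \sum_(j < m) (tnth (u i) j - tnth (l i) j)) g.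
  move=> i _ x w w'; apply: (le_trans (norm1_sub_lipschitz _ _ _)).
  by apply: ler_sum => j _; exact: BD.
set thr := 112%:R / 100%:R * _.
(* Coordinatewise, the mean deviation is at most [3 / 4] of the square root, and
   [3 / 4 <= 112 / 100]. *)
have mean : \int[P]_w g (S w) <= thr.
  have gE w : g (S w) = \sum_(j < m) `|tnth (S w) j - \int[P]_v tnth (S v) j|.
    by apply: eq_bigr => j _; rewrite tnth_mktuple muE.
  under eq_Rintegral do rewrite gE.
  rewrite Rintegral_sum; last first.
    move=> j; apply: (@integrable_norm _ _ _ P setT
      (fun w => tnth (S w) j - \int[P]_v tnth (S v) j)).
    have iS := bounded_differences_integrable (@measurable_vec_add R m)
      (measurable_tnth j) (BD j).
    have imu : P.-integrable setT (EFin \o cst (\int[P]_v tnth (S v) j)).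
      by apply: (@probability_bounded_integrable _ _ _ _ _
        `|\int[P]_v tnth (S v) j|).
    exact: (integrableB measurableT iS imu).
  rewrite /thr mulr_sumr; apply: ler_sum => j _.
  apply: le_trans (mean_deviation_bounded_differences (@measurable_vec_add R m)
    Z_indep us (measurable_tnth j) (BD j)) _.
  under eq_bigr do rewrite -sqrrN opprB.
  by rewrite ler_wpM2r ?sqrtr_ge0//; lra.
have [N [mN PN0 ZYN]] := ZY.
set EvY := [set w | _].
pose EvZ := [set w | delta <= g (S w) - \int[P]_w g (S w)].
(* Off the null set [N] the two sums coincide, and exceeding [thr + delta] means exceeding the mean
   of the norm by [delta], since that mean is at most [thr]. *)
have EvYZ : EvY `<=` EvZ `|` N.
  move=> w Yw; have [ZYw|nZYw] := pselect (forall i, Z i w = Y i w).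
    by left; rewrite /EvZ/= -(YsumS _ ZYw); move: Yw; rewrite /EvY/= -/(g _); lra.
  by right; apply: ZYN.
have mgS : measurable_fun setT (fun w => g (S w)).
  exact: (measurableT_comp mg (measurable_big_op Z (@measurable_vec_add R m) s)).
have mgY : measurable_fun setT (fun w => g (Ysum w)).
  apply: (measurableT_comp mg); apply/measurable_fun_tnthP => j; rewrite /comp.
  under eq_fun do rewrite tnth_mktuple.
  by apply: measurable_sum => i; exact: (measurableT_comp (measurable_tnth j)).
have mEvY : measurable EvY.
  rewrite -[EvY]setTI (_ : EvY = (fun w => g (Ysum w)) @^-1` `[thr + delta, +oo[).
    exact: mgY.
  by apply/seteqP; split=> w /=; rewrite in_itv/= andbT.
have mEvZ : measurable EvZ.
  rewrite -[EvZ]setTI (_ : EvZ =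
    (fun w => g (S w) - \int[P]_w g (S w)) @^-1` `[delta, +oo[).
    by apply: measurable_funB.
  by apply/seteqP; split=> w /=; rewrite in_itv/= andbT.
apply: (@le_trans _ _ (P EvZ)).
  rewrite -[leRHS]adde0 -PN0; apply: le_trans (measureU2 P mEvZ mN).
  by apply: le_measure EvYZ; rewrite inE//; exact: measurableU.
apply: (le_trans (mcdiarmid (@measurable_vec_add R m) Z_indep us mg BDg delta_gt0)).
by rewrite -[leLHS]mul1e lee_pmul ?expeR_ge0// lee_fin ler1n.
Qed.
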